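(* Let $\{\mathbb D_1=\mathbb D_2\}_{\alpha_1,\dots,\alpha_n}$ be a diagrammatic equation with phase variables $\alpha_1,\dots,\alpha_n$ (and no !-boxes) in a graphical calculus with a Laurent polynomial matrix interpretation, as described in the context. For each $j$ let $A_j$ be a set of distinct values for $\alpha_j$ with $$|A_j|=\max(\deg^+_{Y_j}\mathbb D_1,\deg^+_{Y_j}\mathbb D_2)+\max(\deg^-_{Y_j}\mathbb D_1,\deg^-_{Y_j}\mathbb D_2)+1 .$$ If the equation is sound at all $(\alpha_1,\dots,\alpha_n)=(a_1,\dots,a_n)\in A_1\times\dots\times A_n$, i.e. the two sides have equal interpretations when the variables are instantiated at these values, then the equation is sound for all values of $(\alpha_1,\dots,\alpha_n)$.
   Context: Let $K$ be a field. Laurent polynomial interpretation: diagrams whose phases involve formal variables $\alpha_1,\dots,\alpha_n$ are interpreted, by a strict symmetric monoidal functor, as matrices over $K[Y_1,Y_1^{-1},\dots,Y_n,Y_n^{-1}]$, in such a way that instantiating each $\alpha_j$ at a value $a_j$ in the diagram and then interpreting agrees with substituting for each $Y_j$ the element $y(a_j)\in K$ in the matrix, where $a\mapsto y(a)$ is injective. Examples: - Universal ZX ($K=\mathbb C$): phases on Z spiders ($|0\cdots0\rangle\langle0\cdots0|+e^{i\theta}|1\cdots1\rangle\langle1\cdots1|$) and X spiders (same in the basis $|\pm\rangle$) are of the form $\theta=\sum_jn_j\alpha_j+c$ with $n_j\in\mathbb Z$, $c$ constant; $\alpha_j$ takes values in $[0,2\pi)$ and $Y_j=e^{i\alpha_j}$.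 - $\mathrm{ZW}_K$, $\mathrm{RING}_K$, $\mathrm{ZH}_K$ ($\tfrac12\in K$ for ZH): phases are (Laurent) polynomials in the $\alpha_j$ and $Y_j=\alpha_j$, with labelled generators: ZW white spider $|0\cdots0\rangle\langle0\cdots0|+r|1\cdots1\rangle\langle1\cdots1|$; RING state $(1,r)^T$; ZH H-box $\sum r^{i_1\cdots i_mj_1\cdots j_n}|j_1\cdots j_n\rangle\langle i_1\cdots i_m|$ (sum over bits); all other generators have constant matrices. Where negative powers of $\alpha_j$ occur, values of $\alpha_j$ are taken non-zero. Degrees: for a non-zero Laurent polynomial, $\deg^+_{Y}$ is the largest $n\ge0$ with $n=0$ or $Y^n$ occurring, and $\deg^-_{Y}$ the largest $m\ge0$ with $m=0$ or $Y^{-m}$ occurring; the zero polynomial has degree $-\infty$ (if both sides are zero matrices there is no size requirement). The degree of a matrix is the maximum over its entries, and the degree of a diagram is that of its interpretation matrix. *)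

(* Defs.v *)
From HB Require Import structures.
From mathcomp Require Import all_boot all_order all_algebra.
From mathcomp Require Import finmap.
From mathcomp Require Import mxtens.
From mathcomp.multinomials Require Import monalg.

Set Implicit Arguments.
Unset Strict Implicit.
Unset Printing Implicit Defensive.

Import Order.TTheory GRing.Theory Num.Theory.

Local Open Scope fset_scope.
Local Open Scope ring_scope.

(** [laurent K n] is K[Y_0, Y_0^-1, ..., Y_(n-1), Y_(n-1)^-1]: finitely
    supported families of coefficients indexed by exponent vectors in Z^n.
    The additive group is that of [{malg K[_]}].  The product of [monalg] does
    not apply, as it requires a monoid of exponents without invertible
    elements, so the convolution product is defined here. *)

Section Laurent.
Variables (K : comNzRingType) (n : nat).

Definition exponent : choiceType := {ffun 'I_n -> int}.
Definition laurent := {malg K[exponent]}.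

HB.instance Definition _ := GRing.Zmodule.on laurent.

Implicit Types (p q r : laurent) (k : exponent).

Definition lmonomial (c : K) k : laurent := << c *g k >>.

Definition lone : laurent := lmonomial 1 0.

Definition lmul p q : laurent :=
  \sum_(k1 <- msupp p) \sum_(k2 <- msupp q) lmonomial (p@_k1 * q@_k2) (k1 + k2).

Lemma lmonomial0 k : lmonomial 0 k = 0.
Proof. exact: monalgU0. Qed.

Lemma lmonomialD c1 c2 k :
  lmonomial (c1 + c2) k = lmonomial c1 k + lmonomial c2 k.
Proof. exact: monalgUD. Qed.

Lemma lmulE (d1 d2 : {fset exponent}) p q :
  msupp p `<=` d1 -> msupp q `<=` d2 ->
  lmul p q =
  \sum_(k1 <- d1) \sum_(k2 <- d2) lmonomial (p@_k1 * q@_k2) (k1 + k2).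
Proof.
move=> le_d1 le_d2; rewrite /lmul (big_fset_incl _ le_d1) /=.
  apply: eq_bigr => k1 _; apply: big_fset_incl => // k _ /mcoeff_outdom ->.
  by rewrite mulr0 lmonomial0.
move=> k _ /mcoeff_outdom pk.
by rewrite big1 // => k' _; rewrite pk mul0r lmonomial0.
Qed.

Lemma lmulC : commutative lmul.
Proof.
move=> p q; rewrite /lmul exchange_big; apply: eq_bigr => k1 _.
by apply: eq_bigr => k2 _; rewrite mulrC addrC.
Qed.

Lemma lmulDl : left_distributive lmul +%R.
Proof.
move=> p q r.
rewrite (lmulE (msuppD_le p q) (fsubset_refl _)).
rewrite (lmulE (fsubsetUl (msupp p) (msupp q)) (fsubset_refl (msupp r))).
rewrite (lmulE (fsubsetUr (msupp p) (msupp q)) (fsubset_refl (msupp r))).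
rewrite -big_split /=; apply: eq_bigr => k1 _.
rewrite -big_split /=; apply: eq_bigr => k2 _.
by rewrite mcoeffD mulrDl lmonomialD.
Qed.

Lemma lmulDr : right_distributive lmul +%R.
Proof. by move=> p q r; rewrite lmulC lmulDl !(lmulC p). Qed.

Lemma lmul0p : left_zero 0 lmul.
Proof. by move=> p; rewrite /lmul msupp0 big_seq_fset0. Qed.

Lemma lmulp0 : right_zero 0 lmul.
Proof. by move=> p; rewrite lmulC lmul0p. Qed.

Lemma lmulUU c1 c2 k1 k2 :
  lmul (lmonomial c1 k1) (lmonomial c2 k2) = lmonomial (c1 * c2) (k1 + k2).
Proof. by rewrite (lmulE msuppU_le msuppU_le) !big_seq_fset1 !mcoeffUU. Qed.

Lemma lmulA : associative lmul.
Proof.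
have suml I (s : seq I) (F : I -> laurent) q :
    lmul (\sum_(i <- s) F i) q = \sum_(i <- s) lmul (F i) q.
  exact: (big_morph (lmul^~ q) (fun _ _ => lmulDl _ _ _) (lmul0p _)).
have sumr I (s : seq I) (F : I -> laurent) p :
    lmul p (\sum_(i <- s) F i) = \sum_(i <- s) lmul p (F i).
  exact: (big_morph (lmul p) (fun _ _ => lmulDr _ _ _) (lmulp0 _)).
have mulUU := lmulUU; move: lmul suml sumr mulUU => mul suml sumr mulUU p q r.
rewrite (monalgE p) !suml; apply: eq_bigr => k1 _.
rewrite (monalgE q) !(suml, sumr); apply: eq_bigr => k2 _.
rewrite (monalgE r) !sumr; apply: eq_bigr => k3 _.
by rewrite !mulUU mulrA addrA.
Qed.

Lemma lmul1p : left_id lone lmul.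
Proof.
move=> p; rewrite [RHS]monalgE (lmulE msuppU_le (fsubset_refl _)) big_seq_fset1.
by apply: eq_bigr => k _; rewrite mcoeffUU mul1r add0r.
Qed.

Lemma lone_neq0 : lone != 0.
Proof. by rewrite monalgU_eq0 oner_neq0. Qed.

HB.instance Definition _ :=
  GRing.Zmodule_isComNzRing.Build laurent lmulA lmulC lmul1p lmulDl lone_neq0.

End Laurent.

(** [leval y p] replaces each Y_j by [y j].  Since [0^-1 = 0] in MathComp, this
    is a genuine substitution only where every Y_j with [y j = 0] occurs in [p]
    without negative powers, i.e. where [nonneg_in j p]. *)
Definition leval (K : fieldType) (n : nat) (y : 'I_n -> K)
    (p : laurent K n) : K :=
  \sum_(k <- msupp p) p@_k * \prod_(j < n) y j ^ (k j).

Definition nonneg_in (K : fieldType) (n : nat) (j : 'I_n)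
    (p : laurent K n) : Prop :=
  forall k : exponent n, k \in msupp p -> 0 <= k j.

(** Degrees live in [option nat], where [None] stands for -oo. *)
Definition omax : option nat -> option nat -> option nat := oAC maxnA maxnC.

Definition degpos (K : fieldType) (n : nat) (j : 'I_n)
    (p : laurent K n) : option nat :=
  if p == 0 then None else Some (\max_(k <- msupp p) absz (Num.max 0 (k j))%R)%N.

Definition degneg (K : fieldType) (n : nat) (j : 'I_n)
    (p : laurent K n) : option nat :=
  if p == 0 then None else Some (\max_(k <- msupp p) absz (Num.max 0 (- k j))%R)%N.

Definition mxdeg (K : fieldType) (n : nat)
    (deg : laurent K n -> option nat) (a b : nat)
    (M : 'M[laurent K n]_(a, b)) : option nat :=
  \big[omax/None]_(i < a) \big[omax/None]_(j < b) deg (M i j).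

(** [diagram gen P a b] is the type of diagrams with [a] inputs and [b] outputs
    in the PROP freely generated by [gen], where [gen l a b] is the set of
    generators with [l] labels, [a] inputs and [b] outputs (generators without
    phases have [l = 0]), and where the labels are phases taken in [P].
    [Seq D1 D2] is "first D1, then D2".  Diagrams are represented by terms: the
    equations of symmetric monoidal categories are not imposed on the syntax,
    but all hold after interpretation as matrices. *)

Inductive diagram (gen : nat -> nat -> nat -> Type) (P : Type) :
    nat -> nat -> Type :=
| Gen l a b of gen l a b & l.-tuple P : diagram gen P a b
| Wires a : diagram gen P a a
| Swap a b : diagram gen P (a + b) (b + a)
| Seq a b c of diagram gen P a b & diagram gen P b c : diagram gen P a c
| Par a b a' b' of diagram gen P a b & diagram gen P a' b' :
    diagram gen P (a + a') (b + b').

Arguments Wires {gen P} a.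
Arguments Swap {gen P} a b.

Fixpoint map_diagram (gen : nat -> nat -> nat -> Type) (P Q : Type) (f : P -> Q)
    (a b : nat) (D : diagram gen P a b) : diagram gen Q a b :=
  match D with
  | Gen _ _ _ g ps => Gen g (map_tuple f ps)
  | Wires a => Wires a
  | Swap a b => Swap a b
  | Seq _ _ _ D1 D2 => Seq (map_diagram f D1) (map_diagram f D2)
  | Par _ _ _ _ D1 D2 => Par (map_diagram f D1) (map_diagram f D2)
  end.

(** The symmetry R^m (x) R^n -> R^n (x) R^m of the category of matrices. *)
Definition swapmx (R : comNzRingType) (m n : nat) : 'M[R]_(n * m, m * n) :=
  \matrix_(i, j) (((mxtens_unindex i).1 == (mxtens_unindex j).2) &&
                  ((mxtens_unindex i).2 == (mxtens_unindex j).1))%:R.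

(** The strict symmetric monoidal functor to matrices over [R] that sends the
    object 1 to dimension [d] and the generators to [G].  Matrices act on
    column vectors, so a diagram a -> b becomes a (d^b) x (d^a) matrix.  The
    casts are along d^(a + b) = d^a * d^b. *)
Fixpoint interp (gen : nat -> nat -> nat -> Type) (P : Type)
    (R : comNzRingType) (d : nat)
    (G : forall l a b, gen l a b -> l.-tuple P -> 'M[R]_(d ^ b, d ^ a))
    (a b : nat) (D : diagram gen P a b) : 'M[R]_(d ^ b, d ^ a) :=
  match D in diagram _ _ a b return 'M[R]_(d ^ b, d ^ a) with
  | Gen _ _ _ g ps => G _ _ _ g ps
  | Wires a => 1%:M
  | Swap a b =>
      castmx (esym (expnD d b a), esym (expnD d a b)) (swapmx R (d ^ a) (d ^ b))
  | Seq _ _ _ D1 D2 => interp G D2 *m interp G D1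
  | Par a b a' b' D1 D2 =>
      castmx (esym (expnD d b b'), esym (expnD d a a'))
             (interp G D1 *t interp G D2)
  end.

(** [vphase n] is the set of phases in n variables, [cphase] that of phases
    without variables; [yval v] is the element substituted for Y_j when alpha_j
    takes the value [v].  [vmx_inst] asks that instantiation in a generator agree
    with substitution in its matrix wherever the latter is defined; this
    extends to all diagrams by functoriality. *)
Record laurent_calculus (K : fieldType) := LaurentCalculus {
  gens : nat -> nat -> nat -> Type;
  cphase : Type;
  vphase : nat -> Type;
  value : choiceType;
  inst : forall n, ('I_n -> value) -> vphase n -> cphase;
  yval : value -> K;
  yval_inj : injective yval;
  dim : nat;
  cmx : forall l a b, gens l a b -> l.-tuple cphase ->
    'M[K]_(dim ^ b, dim ^ a);
  vmx : forall n l a b, gens l a b -> l.-tuple (vphase n) ->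
    'M[laurent K n]_(dim ^ b, dim ^ a);
  vmx_inst : forall n l a b (g : gens l a b) (ps : l.-tuple (vphase n))
      (x : 'I_n -> value),
    (forall j, yval (x j) != 0 \/ forall r c, nonneg_in j (vmx g ps r c)) ->
    cmx g (map_tuple (inst x) ps) = map_mx (leval (yval \o x)) (vmx g ps)
}.

Arguments yval {K C} _ : rename.
Arguments inst {K C n} _ _ : rename.

Section Calculus.
Variables (K : fieldType) (C : laurent_calculus K).

Definition vdiagram (n a b : nat) := diagram (gens C) (vphase C n) a b.
Definition cdiagram (a b : nat) := diagram (gens C) (cphase C) a b.

Definition instantiate n (x : 'I_n -> value C) a b
  (D : vdiagram n a b) : cdiagram a b := map_diagram (inst x) D.

Definition cinterp a b (D : cdiagram a b) : 'M[K]_(dim C ^ b, dim C ^ a) :=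
  interp (@cmx K C) D.

Definition vinterp n a b (D : vdiagram n a b) :
    'M[laurent K n]_(dim C ^ b, dim C ^ a) :=
  interp (@vmx K C n) D.

Definition degpos_diagram n (j : 'I_n) a b (D : vdiagram n a b) : option nat :=
  mxdeg (degpos j) (vinterp D).

Definition degneg_diagram n (j : 'I_n) a b (D : vdiagram n a b) : option nat :=
  mxdeg (degneg j) (vinterp D).

(** No negative power of the j-th variable occurs in a label of [D].  This
    concerns each generator separately: negative powers that cancel in
    [vinterp D] still prevent [D] from being instantiated at zero. *)
Fixpoint no_negative_power n (j : 'I_n) a b
    (D : diagram (gens C) (vphase C n) a b) : Prop :=
  match D with
  | Gen _ _ _ g ps => forall r c, nonneg_in j (vmx g ps r c)
  | Wires _ | Swap _ _ => True
  | Seq _ _ _ D1 D2 | Par _ _ _ _ D1 D2 =>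
      no_negative_power j D1 /\ no_negative_power j D2
  end.

(** The values that the j-th variable may take in the equation [D1 = D2]. *)
Definition allowed_value n (j : 'I_n) a b (D1 D2 : vdiagram n a b)
    (v : value C) : Prop :=
  yval v != 0 \/ (no_negative_power j D1 /\ no_negative_power j D2).

Definition sound_at n a b (D1 D2 : vdiagram n a b) (x : 'I_n -> value C) :
    Prop :=
  cinterp (instantiate x D1) = cinterp (instantiate x D2).

(** Both maxima are -oo exactly when both interpretations are zero matrices;
    no size is then required. *)
Definition required_size n (j : 'I_n) a b (D1 D2 : vdiagram n a b)
    (size : nat) : Prop :=
  match omax (degpos_diagram j D1) (degpos_diagram j D2),
        omax (degneg_diagram j D1) (degneg_diagram j D2) with
  | Some p, Some q => size = (p + q + 1)%N
  | _, _ => True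
  end.

End Calculus.

(* Main.v *)
(** Where it is defined, substitution in Laurent polynomials is multiplicative,
    so by functoriality instantiating a diagram amounts to substituting in the
    matrix of its interpretation.  It remains to see that a Laurent polynomial
    whose exponents of Y_j lie in [-q_j, p_j] and which vanishes on a product of
    sets with p_j + q_j + 1 elements is zero.  This goes one variable at a time:
    once multiplied by Y_j ^ q_j, it is a polynomial in Y_j with more roots than
    its degree.  If 0 is among the values of Y_j no negative exponent occurs,
    and the shift by q_j, under which 0 would become a spurious root, is
    replaced by no shift. *)

Require Import Defs.
From mathcomp Require Import all_boot all_order all_algebra finmap.
From mathcomp Require Import mxtens zify.
From mathcomp.multinomials Require Import monalg.

Set Implicit Arguments.
Unset Strict Implicit.
Unset Printing Implicit Defensive.

Import Order.TTheory GRing.Theory Num.Theory.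

Section Preliminaries.
Local Open Scope ring_scope.

(** * Vanishing of Laurent polynomials on a product of finite sets *)

(** The one-variable case. Terms are indexed by an arbitrary [k], several of which may share an
    exponent [u k], so that [g k] can absorb the other variables; the conclusion collects the terms
    of exponent [i]. *)
Lemma laurent_coef_eq0 (K : fieldType) (I : eqType) (s : seq I) (P : pred I)
    (g : I -> K) (u : I -> int) (lo hi : nat) (B : seq K) :
    uniq B -> (lo + hi < size B)%N -> (0 \in B -> lo = 0%N) ->
    (forall k, k \in s -> P k -> - lo%:Z <= u k <= hi%:Z) ->
    (forall z, z \in B -> \sum_(k <- s | P k) g k * z ^ u k = 0) ->
  forall i, \sum_(k <- s | P k && (u k == i)) g k = 0.
Proof.
move=> uB szB B0 bnd root_B i.
pose q : {poly K} := \sum_(k <- s | P k) g k *: 'X^`|(u k + lo%:Z)%R|%N.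
have q0 : q = 0.
  apply: (roots_geq_poly_eq0 (rs := B)) => //.
    apply/allP => z zB; rewrite /root horner_sum.
    rewrite (_ : \sum_(_ <- _ | _) _ =
                 (\sum_(k <- s | P k) g k * z ^ u k) * z ^ lo%:Z).
      by rewrite root_B // mul0r.
    rewrite mulr_suml big_seq_cond [RHS]big_seq_cond.
    apply: eq_bigr => k /andP[ks Pk]; have /andP[ge_lo _] := bnd k ks Pk.
    rewrite hornerZ hornerXn -mulrA; congr (_ * _).
    rewrite exprnP gez0_abs; last by lia.
    (* Exponents add freely for [z != 0]; at [z = 0] the hypothesis [B0] makes the shift trivial. *)
    have [z0|z0] := eqVneq z 0; last by rewrite expfzDr.
    by rewrite B0 -?z0 // addr0 expr0z mulr1.
  apply: leq_trans szB; rewrite /q big_seq_cond.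
  elim/big_ind: _ => [|p1 p2 szp1 szp2|k /andP[ks Pk]]; first by rewrite size_poly0.
    by apply: leq_trans (size_polyD _ _) _; rewrite geq_max szp1.
  apply: leq_trans (size_scale_leq _ _) _; rewrite size_polyXn.
  have := bnd k ks Pk; lia.
(* Below [- lo] no exponent occurs; this case is set apart because the absolute value would confuse
   [i + lo] with its opposite. *)
have [i_lo|i_lo] := leP 0 (i + lo%:Z); last first.
  rewrite big_seq_cond big1 // => k /and3P[ks Pk /eqP uki].
  have := bnd k ks Pk; lia.
rewrite -[RHS](coef0 K `|(i + lo%:Z)%R|%N) -q0 coef_sum big_mkcondr /=.
rewrite big_seq_cond [RHS]big_seq_cond; apply: eq_bigr => k /andP[ks Pk].
rewrite coefZ coefXn; have /andP[ge_lo _] := bnd k ks Pk.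
have -> : (`|(i + lo%:Z)%R|%N == `|(u k + lo%:Z)%R|%N) = (u k == i).
  by apply/eqP/eqP; lia.
by case: (u k == i); rewrite (mulr1, mulr0).
Qed.

Lemma laurent_eq0 (K : fieldType) n (h : laurent K n) (lo hi : 'I_n -> nat)
    (B : 'I_n -> seq K) :
    (forall j, uniq (B j)) -> (forall j, lo j + hi j < size (B j))%N ->
    (forall j, 0 \in B j -> lo j = 0%N) ->
    (forall j (k : exponent n), k \in msupp h ->
       - (lo j)%:Z <= k j <= (hi j)%:Z) ->
    (forall y, (forall j, y j \in B j) -> leval y h = 0) ->
  h = 0.
Proof.
move=> uB szB B0 bnd h0.
(* After t steps the first t exponents are fixed, and only the other variables
   are substituted. *)
have claim t : (t <= n)%N ->
    forall (e : exponent n) y, (forall j, y j \in B j) ->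
    \sum_(k <- msupp h | [forall j : 'I_n, (j < t)%N ==> (k j == e j)])
       h@_k * \prod_(j < n | (t <= j)%N) y j ^ k j = 0.
  elim: t => [_ e y yB|t IHt lt_tn e y yB].
    rewrite -[RHS](h0 y yB); apply: eq_bigl => k; exact/forallP.
  pose jt := Ordinal lt_tn.
  (* The variable is [jt]; those after it are evaluated at [y] inside the coefficients. Taking the
     exponent [e jt] fixes one more exponent. *)
  have := @laurent_coef_eq0 K _ (msupp h)
    (fun k => [forall j : 'I_n, (j < t)%N ==> (k j == e j)])
    (fun k => h@_k * \prod_(j < n | (t < j)%N) y j ^ k j)
    (fun k => k jt) (lo jt) (hi jt) (B jt) (uB jt) (szB jt) (B0 jt).
  move=> /(_ _ _ (e jt)) coef0; rewrite -[RHS]coef0; first last.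
  (* The induction hypothesis holds at every point of the grid, so coordinate [jt] may be moved to
     any root [z]. *)
  - move=> z zB; pose y' j := if j == jt then z else y j.
    have y'B j : y' j \in B j by rewrite /y'; case: eqP => [->|].
    rewrite -[RHS](IHt (ltnW lt_tn) e y' y'B); apply: eq_bigr => k _.
    rewrite -mulrA; congr (_ * _); rewrite [RHS](bigD1 jt) //= /y' eqxx mulrC.
    congr (_ * _); apply: eq_big => [j|j lt_tj].
      by rewrite ltn_neqAle andbC eq_sym.
    by rewrite -val_eqE /= gtn_eqF.
  - by move=> k kh _; apply: bnd.
  apply: eq_bigl => k; apply/forallP/andP => [ke|[/forallP ke /eqP kt] j].
    split; last by have := ke jt; rewrite ltnSn.
    by apply/forallP=> j; apply/implyP => jt'; apply: (implyP (ke j)); apply: ltnW.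
  rewrite ltnS leq_eqVlt; apply/implyP => /orP[/eqP jt'|]; last exact/implyP.
  by have -> : j = jt; [apply: val_inj | apply/eqP].
apply/malgP => e; rewrite mcoeff0.
(* After [n] steps nothing is left to substitute, so any point of the grid serves, and only the term
   [k = e] remains. *)
have y0B (j : 'I_n) : (B j)`_0 \in B j by rewrite mem_nth // (leq_ltn_trans _ (szB j)).
have := claim n (leqnn n) e _ y0B.
have [eh|/mcoeff_outdom //] := boolP (e \in msupp h).
rewrite (eq_bigl (pred1 e)) => [|k]; last first.
  apply/forallP/eqP => [ke|-> j]; last by rewrite eqxx implybT.
  by apply/ffunP => j; apply/eqP; have := ke j; rewrite ltn_ord.
rewrite -big_filter filter_pred1_uniq // big_seq1.
by rewrite big1 ?mulr1 // => j; rewrite leqNgt ltn_ord.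
Qed.

(** * Substitution and its compatibility with interpretation *)

Lemma nonneg_in0 (K : fieldType) n (j : 'I_n) : nonneg_in j (0 : laurent K n).
Proof. by move=> k; rewrite msupp0. Qed.

Lemma nonneg_inD (K : fieldType) n (j : 'I_n) (p q : laurent K n) :
  nonneg_in j p -> nonneg_in j q -> nonneg_in j (p + q).
Proof.
move=> pj qj k /(fsubsetP (msuppD_le _ _)); rewrite inE => /orP[].
  exact: pj.
exact: qj.
Qed.

Lemma nonneg_in_sum (K : fieldType) n (j : 'I_n) (I : eqType) (s : seq I)
    (F : I -> laurent K n) :
  (forall i, i \in s -> nonneg_in j (F i)) -> nonneg_in j (\sum_(i <- s) F i).
Proof.
move=> Fj; rewrite big_seq; apply: big_ind => //; first exact: nonneg_in0.
exact: nonneg_inD.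
Qed.

Lemma nonneg_in_monomial (K : fieldType) n (j : 'I_n) (c : K)
    (k : exponent n) :
  0 <= k j -> nonneg_in j (lmonomial c k).
Proof. by move=> kj k' /(fsubsetP msuppU_le); rewrite inE => /eqP ->. Qed.

Lemma nonneg_inM (K : fieldType) n (j : 'I_n) (p q : laurent K n) :
  nonneg_in j p -> nonneg_in j q -> nonneg_in j (p * q).
Proof.
move=> pj qj; apply: nonneg_in_sum => k1 k1p; apply: nonneg_in_sum => k2 k2q.
by apply: nonneg_in_monomial; rewrite ffunE addr_ge0 ?(pj _ k1p) ?(qj _ k2q).
Qed.

Lemma nonneg_in_bool (K : fieldType) n (j : 'I_n) (b : bool) :
  nonneg_in j (b%:R : laurent K n).
Proof.
case: b; last exact: nonneg_in0.
by apply: nonneg_in_monomial; rewrite ffunE.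
Qed.

Lemma levalD (K : fieldType) n (y : 'I_n -> K) : {morph leval y : p q / p + q}.
Proof. exact: (@mmapD _ _ _ idfun). Qed.

Lemma leval0 (K : fieldType) n (y : 'I_n -> K) : leval y 0 = 0.
Proof. exact: (@mmap0 _ _ _ idfun). Qed.

Lemma levalN (K : fieldType) n (y : 'I_n -> K) : {morph leval y : p / - p}.
Proof. exact: (@mmapN _ _ _ idfun). Qed.

Lemma leval_sum (K : fieldType) n (y : 'I_n -> K) I (s : seq I)
    (F : I -> laurent K n) :
  leval y (\sum_(i <- s) F i) = \sum_(i <- s) leval y (F i).
Proof. exact: (big_morph _ (levalD y) (leval0 y)). Qed.

Lemma leval_monomial (K : fieldType) n (y : 'I_n -> K) (c : K)
    (k : exponent n) :
  leval y (lmonomial c k) = c * \prod_(j < n) y j ^ k j.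
Proof. exact: (@mmapU _ _ _ idfun). Qed.

Lemma leval_bool (K : fieldType) n (y : 'I_n -> K) (b : bool) :
  leval y b%:R = b%:R.
Proof.
case: b; last exact: leval0.
by rewrite [LHS]leval_monomial mul1r big1 // => j _; rewrite ffunE.
Qed.

(** Only the exponent law [y ^ (k1 + k2) = y ^ k1 * y ^ k2] is at stake: with [0^-1 = 0] it fails at
    [y = 0] for exponents 1 and -1. *)
Lemma levalM (K : fieldType) n (y : 'I_n -> K) (p q : laurent K n) :
    (forall j, y j != 0 \/ nonneg_in j p /\ nonneg_in j q) ->
  leval y (p * q) = leval y p * leval y q.
Proof.
move=> pq; rewrite [LHS]leval_sum [leval y p]/leval mulr_suml.
apply: eq_big_seq => k1 k1p; rewrite leval_sum [leval y q]/leval mulr_sumr.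
apply: eq_big_seq => k2 k2q; rewrite leval_monomial mulrACA -big_split /=.
congr (_ * _); apply: eq_bigr => j _; rewrite ffunE.
have [y0|[pj qj]] := pq j; first by rewrite expfzDr.
by rewrite exprzD_ss // (pj _ k1p) (qj _ k2q).
Qed.

(** Composition and tensor product only add and multiply entries, which creates no negative
    exponent. *)
Lemma nonneg_in_vinterp (K : fieldType) (C : laurent_calculus K) n (j : 'I_n)
    a b (D : vdiagram C n a b) :
  no_negative_power j D -> forall r c, nonneg_in j (vinterp D r c).
Proof.
rewrite /vinterp; elim: D => {a b} /=.
- by [].
- by move=> a _ r c; rewrite mxE; apply: nonneg_in_bool.
- by move=> a b _ r c; rewrite castmxE mxE; apply: nonneg_in_bool.
- move=> a b c D1 IH1 D2 IH2 [/IH1 D1j /IH2 D2j] r c'; rewrite mxE.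
  by apply: nonneg_in_sum => i _; apply: nonneg_inM.
- move=> a b a' b' D1 IH1 D2 IH2 [/IH1 D1j /IH2 D2j] r c.
  by rewrite castmxE mxE; apply: nonneg_inM.
Qed.

(** Induction on [D], from [vmx_inst] on generators. The condition bears on labels, so it passes to
    subdiagrams, where [nonneg_in_vinterp] supplies what [levalM] requires. *)
Lemma cinterp_instantiate (K : fieldType) (C : laurent_calculus K) n
    (x : 'I_n -> value C) a b (D : vdiagram C n a b) :
    (forall j, yval (x j) != 0 \/ no_negative_power j D) ->
  cinterp (instantiate x D) = map_mx (leval (yval \o x)) (vinterp D).
Proof.
rewrite /cinterp /instantiate /vinterp; elim: D => {a b} /=.
- move=> l a b g ps xD; exact: vmx_inst.
- by move=> a _; apply/matrixP => r c; rewrite !mxE leval_bool.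
- move=> a b _; rewrite map_castmx; congr castmx.
  by apply/matrixP => r c; rewrite !mxE leval_bool.
- move=> a b c D1 IH1 D2 IH2 xD.
  rewrite IH1 => [|j]; last by have [|[]] := xD j; [left|right].
  rewrite IH2 => [|j]; last by have [|[]] := xD j; [left|right].
  apply/matrixP => r s; rewrite !mxE leval_sum; apply: eq_bigr => i _.
  rewrite !mxE levalM // => j; have [|[D1j D2j]] := xD j; first by left.
  by right; split; apply: nonneg_in_vinterp.
- move=> a b a' b' D1 IH1 D2 IH2 xD.
  rewrite IH1 => [|j]; last by have [|[]] := xD j; [left|right].
  rewrite IH2 => [|j]; last by have [|[]] := xD j; [left|right].
  rewrite map_castmx; congr castmx; apply/matrixP => r s; rewrite !mxE levalM //.
  move=> j; have [|[D1j D2j]] := xD j; first by left.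
  by right; split; apply: nonneg_in_vinterp.
Qed.

(** * Degrees as bounds on exponents *)

Lemma omaxxx : idempotent_op omax.
Proof. by case=> // m; rewrite /omax oACE maxnn. Qed.

Lemma omaxA : associative omax.
Proof. exact: Monoid.mulmA. Qed.

(* [omax x y = y] expresses x <= y, with [None] as -oo. *)
Lemma omax_big (I : finType) (F : I -> option nat) i :
  omax (F i) (\big[omax/None]_j F j) = \big[omax/None]_j F j.
Proof.
suff -> : \big[omax/None]_j F j = omax (F i) (\big[omax/None]_(j | j != i) F j).
  by rewrite omaxA omaxxx.
by rewrite /omax (bigD1 i).
Qed.

Lemma omax_mxdeg (K : fieldType) n (deg : laurent K n -> option nat) a b
    (M : 'M[laurent K n]_(a, b)) r c :
  omax (deg (M r c)) (mxdeg deg M) = mxdeg deg M.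
Proof.
pose row_deg i := \big[omax/None]_(j < b) deg (M i j).
rewrite /mxdeg -(omax_big row_deg r) omaxA.
by rewrite (omax_big (fun j => deg (M r j))).
Qed.

Lemma omax_Some m x : omax (Some m) x = x -> exists2 d, x = Some d & (m <= d)%N.
Proof.
case: x => [d|//]; rewrite /omax oACE => -[<-].
by exists (maxn m d); rewrite ?leq_maxl.
Qed.

(** The existence of an exponent [k] excludes degree -oo, so the bound [x] is finite. *)
Lemma degpos_bound (K : fieldType) n (j : 'I_n) (p : laurent K n) x
    (k : exponent n) :
    omax (degpos j p) x = x -> k \in msupp p ->
  exists2 d, x = Some d & k j <= d%:Z.
Proof.
rewrite /degpos; have [->|p0] := eqVneq; first by rewrite msupp0.
move=> /omax_Some[d ->] le_d kp; exists d => //.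
have := leq_trans (leq_bigmax_seq _ kp isT) le_d; lia.
Qed.

Lemma degneg_bound (K : fieldType) n (j : 'I_n) (p : laurent K n) x
    (k : exponent n) :
    omax (degneg j p) x = x -> k \in msupp p ->
  exists2 d, x = Some d & - d%:Z <= k j.
Proof.
rewrite /degneg; have [->|p0] := eqVneq; first by rewrite msupp0.
move=> /omax_Some[d ->] le_d kp; exists d => //.
have := leq_trans (leq_bigmax_seq _ kp isT) le_d; lia.
Qed.

End Preliminaries.

Theorem theorem8p11 (K : fieldType) (C : laurent_calculus K) (n a b : nat)
    (D1 D2 : vdiagram C n a b) (A : 'I_n -> {fset value C})
    (A_values : forall j v, v \in A j -> allowed_value j D1 D2 v)
    (A_size : forall j, required_size j D1 D2 #|` A j|)
    (A_sound : forall x : 'I_n -> value C,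
       (forall j, x j \in A j) -> sound_at D1 D2 x) :
  forall x : 'I_n -> value C,
    (forall j, allowed_value j D1 D2 (x j)) -> sound_at D1 D2 x.
Proof.
have interpE x : (forall j, allowed_value j D1 D2 (x j)) ->
    cinterp (instantiate x D1) = map_mx (leval (yval \o x)) (vinterp D1) /\
    cinterp (instantiate x D2) = map_mx (leval (yval \o x)) (vinterp D2).
  by move=> xA; split; apply: cinterp_instantiate => j;
    have [|[]] := xA j; [left|right|left|right].
suff eqM : vinterp D1 = vinterp D2.
  by move=> x /interpE[E1 E2]; rewrite /sound_at E1 E2 eqM.
apply/matrixP => r c; apply/eqP; rewrite -subr_eq0; apply/eqP.
set h : laurent K n := (_ - _)%R.
pose X j := omax (degpos_diagram j D1) (degpos_diagram j D2).
pose Y j := omax (degneg_diagram j D1) (degneg_diagram j D2).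
have bnd j (k : exponent n) : k \in msupp h ->
    exists p q, [/\ X j = Some p, Y j = Some q & (- q%:Z <= k j <= p%:Z)%R].
  have omax_entry (f : laurent K n -> option nat) (d1 := mxdeg f (vinterp D1))
      (d2 := mxdeg f (vinterp D2)) :
      omax (f (vinterp D1 r c)) (omax d1 d2) = omax d1 d2 /\
      omax (f (vinterp D2 r c)) (omax d1 d2) = omax d1 d2.
    split; last rewrite [omax d1 d2]Monoid.mulmC.
      by rewrite omaxA omax_mxdeg.
    by rewrite omaxA omax_mxdeg.
  have [p1 p2] := omax_entry (degpos j); have [q1 q2] := omax_entry (degneg j).
  move=> /(fsubsetP (msuppB_le _ _)); rewrite inE => /orP[] kM.
    have [p Xp lep] := degpos_bound p1 kM; have [q Yq leq] := degneg_bound q1 kM.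
    by exists p, q; split; rewrite // leq.
  have [p Xp lep] := degpos_bound p2 kM; have [q Yq leq] := degneg_bound q2 kM.
  by exists p, q; split; rewrite // leq.
(* If [h] is non-zero, some exponent [k0] occurs in it; through [bnd] this makes both maxima finite
   for every [j], so that [A_size] prescribes a cardinality. *)
have [//|h0] := eqVneq h 0%R.
have /fset0Pn[k0 k0h] : msupp h != fset0.
  apply: contraNneq h0 => supp0; apply/eqP/malgP => k.
  by rewrite mcoeff0 mcoeff_outdom // supp0.
pose B j := [seq yval v | v <- A j].
have neg j (k : exponent n) : (0%R \in B j) -> k \in msupp h -> (0 <= k j)%R.
  move=> /mapP[v vA /esym v0]; have := A_values _ _ vA.
  rewrite /allowed_value v0 eqxx => -[//|].
  move=> [/nonneg_in_vinterp M1 /nonneg_in_vinterp M2].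
  by move=> /(fsubsetP (msuppB_le _ _)); rewrite inE => /orP[/M1|/M2].
(* The defaults of [odflt] stand for -oo, excluded by [k0]. By injectivity of [yval], [B j] has
   [p + q + 1] distinct elements, one more than the largest possible degree. *)
apply: (@laurent_eq0 K n h
  (fun j => if 0%R \in B j then 0 else odflt 0 (Y j)) (fun j => odflt 0 (X j)) B).
- by move=> j; rewrite map_inj_uniq ?fset_uniq //; apply: yval_inj.
- move=> j; have [p [q [Xp Yq _]]] := bnd j k0 k0h.
  have := A_size j; rewrite /required_size -/(X j) -/(Y j) Xp Yq size_map /= => ->.
  by case: ifP => _; lia.
- by move=> j ->.
- move=> j k kh; have [p [q [-> -> /andP[leq lep]]]] := bnd j k kh.
  by case: ifP => [Bj0|_] /=; rewrite lep ?leq // oppr0 neg.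
move=> y yB.
have [x xA xy] := fin_all_exists2 (fun j => mapP (yB j)).
have [|E1 E2] := interpE x; first by move=> j; apply: A_values.
have := A_sound x xA; rewrite /sound_at E1 E2 => /matrixP/(_ r c).
rewrite !mxE => E.
(* The functions [y] and [yval \o x] are only known to agree pointwise, hence a comparison term by
   term. *)
rewrite (_ : leval y h = leval (yval \o x) h).
  by rewrite levalD levalN E subrr.
by apply: eq_bigr => k _; congr (_ * _)%R; apply: eq_bigr => j _; rewrite xy.
Qed.
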